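(* Let $G$ be a nonempty subset of a $d$-box $X$. Every partition of $G$ into proper boxes of $X$ has at least $|G|_0$ elements. Moreover, $G$ is a polybox if and only if there is a partition of $G$ into proper boxes of $X$ having exactly $|G|_0$ elements.
   Context: A $d$-box is $X=X_1\times\cdots\times X_d$ with finite nonempty sets $X_i$. A box is a nonempty $A_1\times\cdots\times A_d$ with $A_i\subseteq X_i$, proper if $A_i\neq X_i$ for all $i$. Boxes $A,B$ are dichotomous if $A_i=X_i\setminus B_i$ for some $i$; a suit is a family of pairwise dichotomous boxes; a nonempty subset of $X$ is a polybox if it is the union of a suit. Let $\mathcal{O}(X_i)$ be the family of subsets of $X_i$ of odd size. For $B\subseteq X$, $\widehat{B}$ is the set of all $(A_1,\dots,A_d)\in\mathcal{O}(X_1)\times\cdots\times\mathcal{O}(X_d)$ such that $|B\cap(A_1\times\cdots\times A_d)|$ is odd. The box number of $G\subseteq X$ is $|G|_0=2^d|\widehat{G}|/|\widehat{X}|$ (equivalently $|\widehat G|/2^{|X_1|+\cdots+|X_d|-2d}$).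
   Formalization: The ''Moreover'' equivalence is stated only when every X_i has at least two elements; if some X_i is a singleton there are no proper boxes, so the polybox G = X has no partition into proper boxes and the equivalence fails. *)

(* Defs.v *)
From HB Require Import structures.
From mathcomp Require Export all_boot all_order all_algebra.

Set Implicit Arguments.
Unset Strict Implicit.
Unset Printing Implicit Defensive.

Import GRing.Theory Num.Theory.

Section Boxes.

Variables (d : nat) (X : 'I_d -> finType).

Definition point : finType := {dffun forall i : 'I_d, X i}.

(* A box is a subset of X; when it is nonempty its sides are determined by it. *)
Definition is_box (B : {set point}) : Prop :=
  B != set0 /\ exists A : forall i, {set X i}, B = setXn A.

Definition is_proper_box (B : {set point}) : Prop :=
  B != set0 /\
  exists A : forall i, {set X i}, B = setXn A /\ forall i, A i <> [set: X i].

(* Only meaningful for boxes: an empty product could be written with any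
   empty side. *)
Definition dichotomous (B C : {set point}) : Prop :=
  exists (A A' : forall i, {set X i}),
    [/\ B = setXn A, C = setXn A' & exists i, A i = ~: A' i].

Definition suit (F : {set {set point}}) : Prop :=
  (forall B, B \in F -> is_box B) /\
  (forall B C, B \in F -> C \in F -> B <> C -> dichotomous B C).

Definition polybox (G : {set point}) : Prop :=
  G != set0 /\ exists F : {set {set point}}, suit F /\ G = cover F.

Definition hat (B : {set point}) : {set {dffun forall i : 'I_d, {set X i}}} :=
  [set A : {dffun forall i : 'I_d, {set X i}} |
    [forall i, odd #|A i|] && odd #|B :&: setXn A|].

Definition box_number (G : {set point}) : rat :=
  (2%:R ^+ d * #|hat G|%:R / #|hat [set: point]|%:R)%R.

Definition proper_box_partition (P : {set {set point}}) (G : {set point}) : Prop :=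
  partition P G /\ forall B, B \in P -> is_proper_box B.

End Boxes.

(* Main.v *)
Require Import Defs.

(* Given a partition P of G into proper boxes, let n S be the number of B in P
   with S in hat B.  Since #|G :&: S| is the sum of the #|B :&: S|, S lies in
   hat G iff n S is odd, so #|hat G| = sum_S odd (n S) <= sum_S n S
   = sum_B #|hat B|, and each proper box has #|hat B| = #|hat X| / 2^d.  This is
   the lower bound, with equality iff n S <= 1 for all S, i.e. iff the hats of
   the boxes are pairwise disjoint, which for proper boxes means pairwise
   dichotomous. *)

Set Implicit Arguments.
Unset Strict Implicit.
Unset Printing Implicit Defensive.

Import GRing.Theory Num.Theory.

(** * Parity of intersections with sets of odd size *)

Lemma odd_card_bigxor (T : finType) (S : {set T}) :
  odd #|S| = \big[addb/false]_x (x \in S).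
Proof.
rewrite -sum1_card (big_morph odd oddD (erefl _)) big_mkcond.
by apply: eq_bigr => x _; case: (x \in S).
Qed.

Definition symdiff (T : finType) (S U : {set T}) : {set T} :=
  [set x | (x \in S) (+) (x \in U)].

Lemma odd_card_symdiff (T : finType) (S U : {set T}) :
  odd #|symdiff S U| = odd #|S| (+) odd #|U|.
Proof.
rewrite !odd_card_bigxor -big_split /=.
by apply: eq_bigr => x _; rewrite inE.
Qed.

Lemma symdiffK (T : finType) (U : {set T}) : involutive (fun S => symdiff S U).
Proof. by move=> S; apply/setP => x; rewrite !inE addbK. Qed.

Lemma setI_symdiff (T : finType) (B S U : {set T}) :
  B :&: symdiff S U = symdiff (B :&: S) (B :&: U).
Proof. by apply/setP => x; rewrite !inE; case: (x \in B). Qed.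

(** The one-coordinate analogue of [hat]: the hat of a box is the product of these families over its
    sides. *)
Definition odd_meet (T : finType) (B : {set T}) : {set {set T}} :=
  [set S : {set T} | odd #|S| && odd #|B :&: S|].

(* Adding the two points of {b, c}, with b in B and c outside B, keeps the
   parity of #|S| and flips the parity of #|B :&: S|. *)
Lemma card_odd_meet (T : finType) (B : {set T}) :
  B != set0 -> B <> [set: T] -> (2 * #|odd_meet B|)%N = #|odd_meet [set: T]|.
Proof.
move=> /set0Pn[b Bb] /eqP; rewrite -subTset => /subsetPn[c _ Bc].
have bc : b != c by apply: contraNneq Bc => <-.
rewrite -[RHS](cardsID (odd_meet B)) mul2n -addnn; congr (_ + _)%N.
  by apply: eq_card => S; rewrite !inE setTI; case: (odd #|S|).
rewrite -(card_preimset (odd_meet B) (inv_inj (symdiffK [set b; c]))).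
apply: eq_card => S; rewrite !inE setI_symdiff !odd_card_symdiff setTI.
have -> : B :&: [set b; c] = [set b].
  apply/setP => x; rewrite !inE; have [->|] := eqVneq x b; first by rewrite Bb.
  by have [->|_] := eqVneq x c; rewrite ?(negPf Bc) ?andbF.
by rewrite cards2 cards1 bc /=; case: (odd #|S|); case: (odd #|B :&: S|).
Qed.

(** If [B] and [C] share a point, its singleton works. Otherwise they are disjoint but not
    complementary, so some [x] lies outside both, and [x] together with one point of each set forms
    a suitable triple. *)
Lemma exists_odd_meet2 (T : finType) (B C : {set T}) :
  B != set0 -> C != set0 -> B <> ~: C ->
  exists S, (S \in odd_meet B) && (S \in odd_meet C).
Proof.
move=> /set0Pn[b Bb] /set0Pn[c Cc] neqBC.
have [BC0|/set0Pn[x /setIP[Bx Cx]]] := eqVneq (B :&: C) set0; last first.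
  exists [set x]; rewrite !inE cards1.
  by rewrite !(setIidPr _) ?sub1set // cards1.
have notBC x : x \in B -> x \in C -> false.
  by move=> Bx Cx; have := in_set0 x; rewrite -BC0 inE Bx Cx.
have /existsP[x /andP[Bx Cx]] : [exists x, (x \notin B) && (x \notin C)].
  apply: contra_notT neqBC => /existsPn H; apply/setP => x; rewrite inE.
  have := H x; have := @notBC x.
  by case: (x \in B); case: (x \in C) => // /(_ isT isT).
have bC : b \notin C by apply/negP => /(notBC _ Bb).
have cB : c \notin B by apply/negP => /notBC/(_ Cc).
have xb : x != b by apply: contraNneq Bx => ->.
have xc : x != c by apply: contraNneq Cx => ->.
have bc : b != c by apply: contraNneq bC => ->.
exists (x |: [set b; c]); rewrite !inE.
have -> : B :&: (x |: [set b; c]) = [set b].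
  apply/setP => y; rewrite !inE; have [->|_] := eqVneq y x.
    by rewrite (negPf Bx) (negPf xb).
  have [->|_] := eqVneq y b; first by rewrite Bb.
  by have [->|_] := eqVneq y c; rewrite ?(negPf cB) ?andbF.
have -> : C :&: (x |: [set b; c]) = [set c].
  apply/setP => y; rewrite !inE; have [->|_] := eqVneq y x.
    by rewrite (negPf Cx) (negPf xc).
  have [->|_] := eqVneq y c; first by rewrite Cc orbT.
  by have [->|_] := eqVneq y b; rewrite ?(negPf bC) ?andbF.
by rewrite cardsU1 cards2 !cards1 !inE negb_or xb xc bc.
Qed.

(** The [?= iff] form lets the equality case be summed together with the inequality. *)
Lemma odd_leqif (n : nat) : odd n <= n ?= iff (n <= 1).
Proof. by split; case: n => [|[|n]] //=; case: (odd n). Qed.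

Section BoxNumber.

Variables (d : nat) (X : 'I_d -> finType).

Implicit Types (G B C : {set point X}) (P F : {set {set point X}}).
Implicit Types (A : forall i, {set X i}).

(** * Hats of boxes as products *)

Lemma setXnI A A' : setXn A :&: setXn A' = setXn (fun i => A i :&: A' i).
Proof.
apply/setP => x; rewrite inE !in_setXn; apply/andP/forallP.
  by case=> /forallP h /forallP h' i; rewrite inE h h'.
by move=> h; split; apply/forallP => i; have /setIP[] := h i.
Qed.

Lemma setXn_side_neq0 A : setXn A != set0 -> forall i, A i != set0.
Proof. by case/set0Pn => x /setXnP xA i; apply/set0Pn; exists (x i). Qed.

Lemma setXn_neq0 A : (forall i, A i != set0) -> setXn A != set0.
Proof.
by move=> nA; rewrite -card_gt0 cardsXn prodn_gt0 // => i; rewrite card_gt0.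
Qed.

(** Two products of sets meet in a product, and a product of cardinals is odd exactly when every
    factor is. *)
Lemma hat_setXn A : hat (setXn A) = setXn (fun i => odd_meet (A i)).
Proof.
apply/setP => S; rewrite in_setXn inE setXnI cardsXn.
rewrite (big_morph odd oddM (erefl _)) big_all.
apply/andP/forallP => [[/forallP h /allP h'] i|h].
  by rewrite inE h h' // mem_index_enum.
by split; [apply/forallP|apply/allP] => i => [|_]; have := h i;
   rewrite inE => /andP[].
Qed.

Lemma hatT : hat [set: point X] = setXn (fun i => odd_meet [set: X i]).
Proof.
rewrite -hat_setXn; congr hat; apply/setP => x.
by rewrite in_setXn in_setT; apply/esym/forallP => i; rewrite in_setT.
Qed.

(** Each coordinate contributes one factor 2, by [card_odd_meet]. *)
Lemma card_hat_proper B : is_proper_box B ->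
  (2 ^ d * #|hat B|)%N = #|hat [set: point X]|.
Proof.
case=> nB [A [eB pA]]; rewrite hatT eB hat_setXn !cardsXn.
have -> : (2 ^ d)%N = \prod_(i < d) 2 by rewrite prod_nat_const card_ord.
rewrite -big_split /=.
by apply: eq_bigr => i _; rewrite card_odd_meet //; apply: setXn_side_neq0; rewrite -eB.
Qed.

Lemma card_hatT_gt0 : (forall i, 0 < #|X i|) -> 0 < #|hat [set: point X]|.
Proof.
move=> hX; rewrite hatT cardsXn prodn_gt0 // => i.
have /card_gt0P[x _] := hX i; apply/card_gt0P; exists [set x].
by rewrite inE setTI cards1.
Qed.

(** * Counting hats along a partition *)

Lemma mem_hat_partition P G (A : {dffun forall i, {set X i}}) : partition P G ->
  (A \in hat G) = odd (\sum_(B in P) (A \in hat B)).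
Proof.
case/and3P=> /eqP <- tP _; rewrite inE.
have -> : #|cover P :&: setXn A| = \sum_(B in P) #|B :&: setXn A|.
  rewrite -sum1_card (eq_bigl _ _ (fun x => in_setI x _ _)) big_trivIset_cond //.
  by apply: eq_bigr => B _; rewrite -sum1_card; apply/esym/eq_bigl => x; rewrite inE.
rewrite !(big_morph odd oddD (erefl _)).
(* If some side of [A] has even size, [A] belongs to no hat and both parities vanish. *)
case: (boolP [forall i, odd #|A i|]) => hA /=.
  by apply: eq_bigr => B _; rewrite inE hA oddb.
by rewrite big1 // => B _; rewrite inE (negPf hA).
Qed.

Lemma card_hat_partition P G : partition P G ->
  #|hat G| <= \sum_(B in P) #|hat B|
    ?= iff [forall S : {dffun forall i, {set X i}},
              \sum_(B in P) (S \in hat B) <= 1].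
Proof.
move=> pP.
have card_sum (H : {set {dffun forall i, {set X i}}}) : #|H| = \sum_S (S \in H).
  by rewrite -sum1_card big_mkcond; apply: eq_bigr => S _; case: (S \in H).
rewrite (eq_bigr _ (fun B _ => card_sum (hat B))) exchange_big card_sum /=.
rewrite (eq_bigr _ (fun S _ => congr1 nat_of_bool (mem_hat_partition S pP))).
by apply: leqif_sum => S _; apply: odd_leqif.
Qed.

(** The bound on the box number with denominators cleared, so that the argument stays in [nat]. *)
Lemma card_hat_proper_partition P G : proper_box_partition P G ->
  2 ^ d * #|hat G| <= #|P| * #|hat [set: point X]|
    ?= iff [forall S : {dffun forall i, {set X i}},
              \sum_(B in P) (S \in hat B) <= 1].
Proof.
case=> pP prP; have [le eqiff] := card_hat_partition pP.
have <- : (2 ^ d * \sum_(B in P) #|hat B|)%N = (#|P| * #|hat [set: point X]|)%N.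
  rewrite big_distrr -sum_nat_const; apply: eq_bigr => B PB.
  exact/card_hat_proper/prP.
by split; rewrite ?leq_pmul2l ?eqn_pmul2l ?expn_gt0.
Qed.

(** * Dichotomy and disjointness of hats *)

Lemma dichotomous_disjoint_hat B C : dichotomous B C -> [disjoint hat B & hat C].
Proof.
case=> A [A' [-> -> [i eA]]]; apply/pred0P => S /=; rewrite !hat_setXn.
apply/andP => -[/setXnP/(_ i) SB /setXnP/(_ i)]; move: SB.
rewrite !inE => /andP[oS oB] /andP[_ oC]; move: oS.
(* [S i] is split by [A' i] and its complement [A i]; two odd parts would make its size even. *)
by rewrite -(cardsID (A' i)) setIC oddD oC setDE -eA setIC oB.
Qed.

(** When no pair of sides is complementary, [exists_odd_meet2] applies in each coordinate, and the
    chosen sets together form a common element of the two hats. *)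
Lemma disjoint_hat_dichotomous B C : is_box B -> is_box C ->
  [disjoint hat B & hat C] -> dichotomous B C.
Proof.
case=> nB [A eB] [nC [A' eC]] dBC; exists A, A'; split=> //.
case: (boolP [exists i, A i == ~: A' i]) => [/existsP[i /eqP]|]; first by exists i.
move=> /existsPn nA.
have ex i : exists S, (S \in odd_meet (A i)) && (S \in odd_meet (A' i)).
  by apply: exists_odd_meet2; [apply: setXn_side_neq0; rewrite -eB
    | apply: setXn_side_neq0; rewrite -eC | apply/eqP].
pose S : {dffun forall i, {set X i}} := [ffun i => xchoose (ex i)].
have /andP[] : (S \in hat B) && (S \in hat C); last first.
  by move=> SB SC; have := disjointFr dBC SB; rewrite SC.
rewrite eB eC !hat_setXn; apply/andP.
by split; apply/setXnP => i; rewrite ffunE; have /andP[] := xchooseP (ex i).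
Qed.

Lemma dichotomous_disjoint B C : dichotomous B C -> [disjoint B & C].
Proof.
case=> A [A' [-> -> [i eA]]]; apply/pred0P => x /=.
by apply/andP => -[/setXnP/(_ i) + /setXnP/(_ i)]; rewrite eA inE => /negPf->.
Qed.

Lemma proper_box_is_box B : is_proper_box B -> is_box B.
Proof. by case=> nB [A [eB _]]; split=> //; exists A. Qed.

Lemma suit_sum_hat P :
  (forall B C, B \in P -> C \in P -> B <> C -> dichotomous B C) ->
  forall S : {dffun forall i, {set X i}}, \sum_(B in P) (S \in hat B) <= 1.
Proof.
move=> dP S; case: (pickP (fun B => (B \in P) && (S \in hat B))) => [B|none].
  case/andP=> PB SB; rewrite (bigD1 B) //= SB big1 // => C /andP[PC CB].
  have /dichotomous_disjoint_hat dCB : dichotomous B C.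
    by apply: dP => // eBC; rewrite eBC eqxx in CB.
  by rewrite (disjointFr dCB SB).
by rewrite big1 // => B PB; have := none B; rewrite PB /= => ->.
Qed.

(** A common element of two distinct boxes' hats would be counted twice in the sum. *)
Lemma sum_hat_dichotomous P :
  (forall B, B \in P -> is_box B) ->
  (forall S : {dffun forall i, {set X i}}, \sum_(B in P) (S \in hat B) <= 1) ->
  forall B C, B \in P -> C \in P -> B <> C -> dichotomous B C.
Proof.
move=> bP leP B C PB PC BC; apply: disjoint_hat_dichotomous; try exact: bP.
apply/pred0P => S /=; apply/andP => -[SB SC]; have := leP S.
rewrite (bigD1 B) //= SB (bigD1 C) /= ?SC //.
by rewrite PC; apply/eqP => eCB; apply: BC.
Qed.

(** * Cutting the boxes of a suit into proper boxes *)

Definition split_side (g : point X) A (e : {ffun 'I_d -> bool}) (i : 'I_d) :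
    {set X i} :=
  if A i == [set: X i] then if e i then [set g i] else ~: [set g i] else A i.

(** Makes the sides a function of the box, in place of the existential witness in [is_box]. *)
Definition proj_side B (i : 'I_d) : {set X i} := [set x i | x : point X in B].

Lemma proj_side_setXn A : setXn A != set0 -> forall i, proj_side (setXn A) i = A i.
Proof.
move=> /[dup] nA /set0Pn[x /setXnP xA] i; apply/setP => a; apply/imsetP/idP.
  by case=> y /setXnP yA ->.
(* The point [x] of the box with its coordinate [i] replaced by [a]. *)
move=> Aa; exists [ffun j => @dfwith _ X x i a j] => /=; last first.
  by rewrite ffunE dfwith_in.
by apply/setXnP => j; rewrite ffunE; case: dfwithP => // k _; apply: xA.
Qed.

Lemma box_proj_side B : is_box B -> B = setXn (proj_side B).
Proof.
case=> nB [A eB]; rewrite {1}eB; apply: eq_setXn => i.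
by rewrite eB proj_side_setXn // -eB.
Qed.

Lemma split_side_proper g A e : (forall i, 1 < #|X i|) ->
  forall i, split_side g A e i <> [set: X i].
Proof.
move=> hX i; rewrite /split_side; case: eqP => // _.
by have := hX i; case: (e i) => /[swap] /setP eT;
  [rewrite -cardsT -(eq_card eT) cards1 | have := eT (g i); rewrite !inE eqxx].
Qed.

(** A second point in [X i] keeps the complement of [g i] nonempty. *)
Lemma split_side_neq0 g A e : (forall i, 1 < #|X i|) -> (forall i, A i != set0) ->
  forall i, split_side g A e i != set0.
Proof.
move=> hX nA i; rewrite /split_side; case: ifP => // _; case: (e i).
  by apply/set0Pn; exists (g i); rewrite inE.
by rewrite -card_gt0 cardsC1 -ltnS prednK // ltnW.
Qed.

Lemma split_side_sub g A e i : split_side g A e i \subset A i.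
Proof. by rewrite /split_side; case: eqP => // ->; apply: subsetT. Qed.

(** Bits of [e] at non-full sides are ignored, so different [e] can give the same piece; the
    hypothesis is therefore on the pieces. Distinct pieces take opposite halves of some full
    side. *)
Lemma split_side_self g A e e' : setXn (split_side g A e) <> setXn (split_side g A e') ->
  exists i, split_side g A e i = ~: split_side g A e' i.
Proof.
move=> ne; suff /existsP[i /eqP ei] :
    [exists i, split_side g A e i == ~: split_side g A e' i] by exists i.
apply: contra_notT ne => /existsPn h; apply: eq_setXn => i.
have := h i; rewrite /split_side; case: ifP => // _.
by case: (e i); case: (e' i); rewrite // ?setCK eqxx.
Qed.

Lemma split_side_compl g A A' e e' i : A i != set0 -> A' i != set0 ->
  A i = ~: A' i -> split_side g A e i = ~: split_side g A' e' i.
Proof.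
move=> nA nA' eA.
have pA : A i != [set: X i].
  by apply: contraNneq nA' => eT; rewrite -setCT -eT eA setCK.
have pA' : A' i != [set: X i].
  by apply: contraNneq nA => eT; rewrite eA eT setCT.
by rewrite /split_side (negPf pA) (negPf pA').
Qed.

(* Cutting every full side X i of a box of the suit into {g i} and its
   complement makes all boxes proper; the sides witnessing dichotomy are never
   full, so they survive. *)
Lemma polybox_proper_suit G : (forall i, 1 < #|X i|) -> polybox G ->
  exists P, [/\ G = cover P, forall B, B \in P -> is_proper_box B &
    forall B C, B \in P -> C \in P -> B <> C -> dichotomous B C].
Proof.
move=> hX [/set0Pn[g Gg] [F [[bF dF] eG]]].
pose piece (u : {set point X} * {ffun 'I_d -> bool}) :=
  setXn (split_side g (proj_side u.1) u.2).
have side_neq0 B : B \in F -> forall i, proj_side B i != set0.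
  move=> FB; apply: setXn_side_neq0; rewrite -box_proj_side; last exact: bF.
  by have [] := bF B FB.
exists [set piece (B, e) | B in F, e in [set: {ffun 'I_d -> bool}]]; split.
- rewrite eG; apply/setP => x; apply/bigcupP/bigcupP.
    (* [e] records in which half each coordinate of [x] falls. *)
    move=> [B FB Bx]; pose e := [ffun i => x i == g i].
    exists (piece (B, e)); first by apply/imset2P; exists B e; rewrite ?inE.
    apply/setXnP => i; rewrite /split_side /= ffunE.
    have Bxi : x i \in proj_side B i by apply: imset_f.
    by case: eqP => // _; case: (boolP (x i == g i)); rewrite !inE.
  move=> [_ /imset2P[B e FB _ ->] /setXnP h]; exists B => //.
  rewrite (box_proj_side (bF B FB)); apply/setXnP => i.
  exact: (subsetP (split_side_sub _ _ _ i) _ (h i)).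
- move=> _ /imset2P[B e FB _ ->]; split.
    by apply: setXn_neq0; apply: split_side_neq0 => //; apply: side_neq0.
  by eexists; split; [reflexivity | apply: split_side_proper].
move=> _ _ /imset2P[B e FB _ ->] /imset2P[C e' FC _ ->] ne.
exists (split_side g (proj_side B) e), (split_side g (proj_side C) e').
(* Pieces of one box are separated at a side that was cut; pieces of different boxes at the side
   where those boxes were already complementary. *)
split=> //; have [eBC|/eqP neBC] := eqVneq B C.
  by move: ne; rewrite /piece /= eBC; apply: split_side_self.
have [A [A' [eB eC [i eA]]]] := dF B C FB FC neBC.
have [nB _] := bF B FB; have [nC _] := bF C FC.
exists i; apply: split_side_compl; try exact: side_neq0.
by rewrite eB eC !proj_side_setXn -?eB -?eC.
Qed.

End BoxNumber.

Theorem theorem2p4 (d : nat) (X : 'I_d -> finType)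
    (hX : forall i, 0 < #|X i|)
    (G : {set point X}) (hG : G != set0) :
  (forall P : {set {set point X}}, proper_box_partition P G ->
     (box_number G <= #|P|%:R)%R) /\
  ((forall i, 1 < #|X i|) ->
     (polybox G <->
      exists P : {set {set point X}},
        proper_box_partition P G /\ (#|P|%:R)%R = box_number G)).
Proof.
have hT := card_hatT_gt0 hX.
have hTr : (0 < #|hat [set: point X]|%:R :> rat)%R by rewrite ltr0n.
split=> [P /card_hat_proper_partition[le _]|hX1].
  by rewrite /box_number ler_pdivrMr // -natrX -!natrM ler_nat.
have box_numberE P : proper_box_partition P G ->
    (#|P|%:R == box_number G)%R <->
    forall A : {dffun forall i, {set X i}}, \sum_(B in P) (A \in hat B) <= 1.
  move=> /card_hat_proper_partition[_ eqiff].
  (* Multiplying by the positive denominator reduces the claim to the equality case of the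
     inequality in [nat]. *)
  have <- : (2 ^ d * #|hat G| == #|P| * #|hat [set: point X]|) =
      (#|P|%:R == box_number G)%R.
    rewrite /box_number [RHS]eq_sym -(inj_eq (mulIf (lt0r_neq0 hTr))).
    by rewrite divfK ?lt0r_neq0 // -natrX -!natrM eqr_nat.
  by rewrite eqiff; split=> /forallP.
split=> [/(polybox_proper_suit hX1)[P [eG prP dP]]|[P [pP /eqP/(box_numberE P pP) le]]].
  have pP : proper_box_partition P G.
    split=> //; apply/and3P; split; first by rewrite eG.
      apply/trivIsetP => B C PB PC /eqP BC.
      exact/dichotomous_disjoint/dP.
    by apply/negP => /prP[]; rewrite eqxx.
  by exists P; split=> //; apply/eqP/(box_numberE P pP)/suit_sum_hat.
have [/and3P[/eqP eG _ _] prP] := pP.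
have bP B : B \in P -> is_box B by move=> /prP/proper_box_is_box.
(* The partition itself is the required suit, its hats being pairwise disjoint. *)
split=> //; exists P; split=> //; split=> //.
exact: sum_hat_dichotomous.
Qed.
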